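(* Let the ground truth be denoted by $\mathbf{x}_t = g(\mathbf{x}_{t-1})$ and the states from the learned model by $\hat{\mathbf{x}}_t = f_\theta(\hat{\mathbf{x}}_{t-1})$. Define the newly generated step error at step $t$ as $\boldsymbol{\epsilon}_t \triangleq f_\theta(\mathbf{x}_{t-1}) - \mathbf{x}_t$, and the error at step $t$ as $\mathbf{e}_t \triangleq \hat{\mathbf{x}}_t - \mathbf{x}_t$. Assume the ground truth $g$ and the model error function $\epsilon(\mathbf{x}) \triangleq f_\theta(\mathbf{x}) - g(\mathbf{x})$ are differentiable with Jacobians $\mathbf{J}_g$ and $\mathbf{J}_\epsilon$, respectively. If $\mathbf{e}_{t-1}$ is sufficiently small, then $\mathbf{e}_t$ obeys the (approximate) recurrence relation $$\mathbf{e}_t \approx \bigl(\mathbf{J}_g(\mathbf{x}_{t-1}) + \mathbf{J}_\epsilon(\mathbf{x}_{t-1})\bigr)\,\mathbf{e}_{t-1} + \boldsymbol{\epsilon}_t .$$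
   Context: Weather states are treated as flattened vectors $\mathbf{x}\in\mathbb{R}^d$. The map $g$ is the ground truth dynamics taking the true state at step $t-1$ to the true state at step $t$; $f_\theta$ is the learned forecasting model with parameters $\theta$, applied autoregressively, so that $\hat{\mathbf{x}}_t$ is obtained by feeding the model's own previous state $\hat{\mathbf{x}}_{t-1}$ back as input. Accordingly $\mathbf{e}_{t-1} = \hat{\mathbf{x}}_{t-1} - \mathbf{x}_{t-1}$. The symbol $\approx$ is used informally, for an approximation obtained from the first-order Taylor expansion of $f_\theta$ around $\mathbf{x}_{t-1}$; no quantitative error bound is stated. *)

(* Defs.v *)
From HB Require Import structures.
From mathcomp Require Import all_boot all_order all_algebra.
From mathcomp Require Import all_classical all_reals all_analysis.

Set Implicit Arguments.
Unset Strict Implicit.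
Unset Printing Implicit Defensive.

Import Order.TTheory GRing.Theory Num.Theory.
Import numFieldNormedType.Exports.
Local Open Scope ring_scope.

(* States are row vectors, and the Jacobian matrix ['J f p] of the library acts
   on row vectors from the right: [v *m 'J f p] is the transpose of the usual
   product of the Jacobian matrix of f at p with the column vector v. *)

Definition is_trajectory (T : Type) (phi : T -> T) (x : nat -> T) : Prop :=
  forall t, (0 < t)%N -> x t = phi (x t.-1).

Definition model_error (R : realType) (d : nat)
    (f g : 'rV[R]_d -> 'rV[R]_d) (p : 'rV[R]_d) : 'rV[R]_d :=
  f p - g p.

(* Only used for t > 0, because of the truncated predecessor. *)
Definition step_error (R : realType) (d : nat)
    (f : 'rV[R]_d -> 'rV[R]_d) (x : nat -> 'rV[R]_d) (t : nat) : 'rV[R]_d :=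
  f (x t.-1) - x t.

Definition forecast_error (R : realType) (d : nat)
    (xhat x : nat -> 'rV[R]_d) (t : nat) : 'rV[R]_d :=
  xhat t - x t.

(* Main.v *)
Require Import Defs.
From HB Require Import structures.
From mathcomp Require Import all_boot all_order all_algebra.
From mathcomp Require Import all_classical all_reals all_analysis.

Set Implicit Arguments.
Unset Strict Implicit.
Unset Printing Implicit Defensive.

Import Order.TTheory GRing.Theory Num.Theory.
Import numFieldNormedType.Exports.
Local Open Scope ring_scope.

(** Since [f theta] is [g] plus the model error, it is differentiable and its Jacobian is the sum of
    the two ([jacobianD]). Expand [f theta] to first order at the true previous state, with the
    previous forecast error as increment: the defect of the recurrence is exactly the Taylor
    remainder, which [differentiable_jacobian_remainder] bounds. *)

(** Row [i] of a Jacobian is the differential at the [i]-th basis vector, so additivity of the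
    differential transfers row by row. *)
Lemma jacobianD (R : numFieldType) (m n : nat) (f g : 'rV[R]_m -> 'rV[R]_n)
    (p : 'rV[R]_m) :
  differentiable f p -> differentiable g p -> 'J (f + g) p = 'J f p + 'J g p.
Proof.
move=> f_diff g_diff; apply/row_matrixP => i.
rewrite rowE [RHS]rowE mulmxDr [LHS]mul_rV_lin1 (diffD f_diff g_diff).
rewrite [X in _ = X + _]mul_rV_lin1 [X in _ = _ + X]mul_rV_lin1.
reflexivity.
Qed.

Lemma differentiable_jacobian_remainder (R : numFieldType) (m n : nat)
    (f : 'rV[R]_m -> 'rV[R]_n) (p : 'rV[R]_m) :
  differentiable f p -> forall eta : R, 0 < eta ->
  exists2 delta : R, 0 < delta &
  forall h, `|h| < delta -> `|f (h + p) - (f p + h *m 'J f p)| <= eta * `|h|.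
Proof.
move=> f_diff eta eta_gt0.
have /eqaddoP/(_ _ eta_gt0) := diff_locally f_diff.
case/nbhs_norm0P => delta /= delta_gt0 small; exists delta => // h h_small.
(* The derivative along [h] links the matrix product to the differential. *)
by rewrite -deriveEjacobian // deriveE //; exact: small.
Qed.

(* The approximate equality is read as equality up to a remainder that is
   little-o of the norm of the previous error, as this error tends to 0. *)
Theorem proposition3p1 (R : realType) (d : nat) (Theta : Type)
    (g : 'rV[R]_d -> 'rV[R]_d) (f : Theta -> 'rV[R]_d -> 'rV[R]_d)
    (theta : Theta)
    (g_diff : forall p, differentiable g p)
    (eps_diff : forall p, differentiable (model_error (f theta) g) p)
    (x : nat -> 'rV[R]_d) (x_traj : is_trajectory g x)
    (t : nat) (t_gt0 : (0 < t)%N) :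
  forall eta : R, 0 < eta ->
  exists2 delta : R, 0 < delta &
  forall xhat : nat -> 'rV[R]_d, is_trajectory (f theta) xhat ->
    `|forecast_error xhat x t.-1| < delta ->
    `|forecast_error xhat x t
      - (forecast_error xhat x t.-1
           *m ('J g (x t.-1) + 'J (model_error (f theta) g) (x t.-1))
         + step_error (f theta) x t)|
    <= eta * `|forecast_error xhat x t.-1|.
Proof.
have f_split : f theta = g + model_error (f theta) g.
  by apply/funext => p; rewrite /model_error fctE addrC subrK.
have f_diff : differentiable (f theta) (x t.-1).
  by rewrite f_split; exact: differentiableD.
have jacobian_f : 'J (f theta) (x t.-1)
    = 'J g (x t.-1) + 'J (model_error (f theta) g) (x t.-1).
  by rewrite -(jacobianD (g_diff _) (eps_diff _)) -f_split.
move=> eta /(differentiable_jacobian_remainder f_diff)[delta delta_gt0 small].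
(* This [delta] comes from [f theta] and [x t.-1] alone, so it serves every [xhat]. *)
exists delta => // xhat xhat_traj /small.
(* The shifted point is [xhat t.-1], sent to [xhat t] because [0 < t]; the two copies of [x t] then
   cancel. *)
rewrite -jacobian_f /step_error /forecast_error subrK -xhat_traj //.
by rewrite addrA [_ *m _ + _]addrC opprB addrA subrK.
Qed.
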